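(* Let $(\mathcal{S},\mathcal{A},p,r)$ be a finite Markov decision process with discount factor $\gamma\in[0,1)$, and let $Q^*$ denote its optimal action-value function, i.e. the unique solution of the Bellman optimality equation $Q^*(s,a)=\mathbb{E}[r(s,a)]+\gamma\,\mathbb{E}_{s'\sim p(\cdot\mid s,a)}\big[\max_{a'}Q^*(s',a')\big]$. Let $g:\mathbb{R}^3\to\mathbb{R}$ be either of the following target mappings: (i) $g(x,y,z)=$ the mean of the two smallest of $x,y,z$; or (ii) $g(x,y,z)=$ the median of $x,y,z$. Clipped Triple Q-learning maintains three lookup tables $Q^A_t,Q^B_t,Q^C_t:\mathcal{S}\times\mathcal{A}\to\mathbb{R}$ (arbitrary initial tables $Q^A_0,Q^B_0,Q^C_0$). At each time step $t=0,1,2,\dots$, a state-action pair $(s_t,a_t)$ is visited, a reward $r_t$ (a sample of $r(s_t,a_t)$) and next state $s_{t+1}\sim p(\cdot\mid s_t,a_t)$ are observed, and with $a^*=\arg\max_a Q^A_t(s_{t+1},a)$ and $$y_t=r_t+\gamma\, g\big(Q^A_t(s_{t+1},a^* ),\,Q^B_t(s_{t+1},a^* ),\,Q^C_t(s_{t+1},a^* )\big),$$ every table $X\in\{A,B,C\}$ is updated by $$Q^X_{t+1}(s,a)=Q^X_t(s,a)+\alpha_t(s,a)\big(y_t-Q^X_t(s,a)\big)\quad\text{if }(s,a)=(s_t,a_t),$$ and $Q^X_{t+1}(s,a)=Q^X_t(s,a)$ otherwise. Assume: (1) each state-action pair is visited infinitely often; (2) the learning rates satisfy $\alpha_t(s,a)\in[0,1]$,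 $\sum_t\alpha_t(s,a)=\infty$ and $\sum_t\alpha_t(s,a)^2<\infty$ with probability 1, and $\alpha_t(s,a)=0$ for all $(s,a)\neq(s_t,a_t)$; (3) $\mathrm{Var}[r(s,a)]<\infty$ for all $(s,a)$. Then, with probability 1, each of $Q^A_t$, $Q^B_t$, $Q^C_t$ converges to $Q^*$ as $t\to\infty$.
   Context: Rewards $r(s,a)$ are random variables with finite variance; $p(\cdot\mid s,a)$ is the transition distribution. The learning rates $\alpha_t(s,a)$ may be random but are determined by the history $\{Q^A_0,Q^B_0,Q^C_0,s_0,a_0,\alpha_0,r_0,s_1,\dots,s_t,a_t\}$ up to time $t$. Ties in $\arg\max$ are broken by an arbitrary fixed rule. *)

(* Defs.v *)
From HB Require Import structures.
From mathcomp Require Import all_boot all_order all_algebra.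
From mathcomp Require Import all_classical all_reals all_analysis.
Set Implicit Arguments. Unset Strict Implicit. Unset Printing Implicit Defensive.
Import Order.TTheory GRing.Theory Num.Theory.
Import numFieldNormedType.Exports.
Local Open Scope classical_set_scope.
Local Open Scope ring_scope.

Inductive tbl := TA | TB | TC.

Section Defs.
Variable R : realType.

Definition mean_two_smallest (x y z : R) : R :=
  (x + y + z - Num.max x (Num.max y z)) / 2.

Definition median3 (x y z : R) : R :=
  x + y + z - Num.max x (Num.max y z) - Num.min x (Num.min y z).

Definition fmax (A : finType) (a0 : A) (f : A -> R) : R :=
  \big[Num.max/f a0]_(a : A) f a.

Definition mean_reward (rho : probability R R) : R :=
  fine (\int[rho]_x (x%:E))%E.

Variables (S A : finType).

Definition ctq_step (gamma : R) (g : R -> R -> R -> R)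
  (amax : S -> (A -> R) -> A)
  (s_t : S) (a_t : A) (r_t : R) (s_next : S) (alpha_t : S -> A -> R)
  (Q : tbl -> S -> A -> R) : tbl -> S -> A -> R :=
  let astar := amax s_next (Q TA s_next) in
  let y := r_t + gamma * g (Q TA s_next astar) (Q TB s_next astar)
                           (Q TC s_next astar) in
  fun X s a => if (s == s_t) && (a == a_t)
               then Q X s a + alpha_t s a * (y - Q X s a)
               else Q X s a.

Fixpoint ctq (gamma : R) (g : R -> R -> R -> R) (amax : S -> (A -> R) -> A)
  (Q0 : tbl -> S -> A -> R) (s_ : nat -> S) (a_ : nat -> A) (r_ : nat -> R)
  (alpha : nat -> S -> A -> R) (t : nat) : tbl -> S -> A -> R :=
  match t with
  | 0 => Q0
  | t'.+1 => ctq_step gamma g amax (s_ t') (a_ t') (r_ t') (s_ t'.+1) (alpha t')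
               (ctq gamma g amax Q0 s_ a_ r_ alpha t')
  end.

Variables (d : measure_display) (T : measurableType d).

Definition history_gen (Q0 : tbl -> T -> S -> A -> R) (s_ : nat -> T -> S)
  (a_ : nat -> T -> A) (r_ : nat -> T -> R) (alpha : nat -> T -> S -> A -> R)
  (t : nat) : set (set T) :=
  [set E | (exists X s a (B : set R), measurable B /\
              E = (fun w => Q0 X w s a) @^-1` B)
        \/ (exists i s, (i <= t)%N /\ E = s_ i @^-1` [set s])
        \/ (exists i a, (i <= t)%N /\ E = a_ i @^-1` [set a])
        \/ (exists i (B : set R), (i < t)%N /\ measurable B /\ E = r_ i @^-1` B)
        \/ (exists i s a (B : set R), (i < t)%N /\ measurable B /\
              E = (fun w => alpha i w s a) @^-1` B)].

Definition history (Q0 : tbl -> T -> S -> A -> R) (s_ : nat -> T -> S)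
  (a_ : nat -> T -> A) (r_ : nat -> T -> R) (alpha : nat -> T -> S -> A -> R)
  (t : nat) : set (set T) :=
  <<s history_gen Q0 s_ a_ r_ alpha t >>.

End Defs.

(* Main.v *)
(** All three tables receive the same target with the same rate, so their
    differences are multiplied by [1 - alpha] and vanish on every path; hence
    the target is [r + gamma * max QA(s', .)] up to a vanishing error.  The rest
    is a coupling argument.  The only noise that has to be averaged out is
    [alpha * (r + gamma * max Qstar(s', .) - Qstar)], which involves the fixed
    table [Qstar] instead of the iterates: it has bounded conditional variance,
    so its series converges almost surely, and no measurability or boundedness
    of the iterates is needed (the tie-breaking rule may well be
    non-measurable).  Along such a path the error is an asynchronous
    [gamma]-contraction with a vanishing perturbation, hence tends to 0. *)

Require Import Defs.
From HB Require Import structures.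
From mathcomp Require Import all_boot all_order all_algebra.
From mathcomp Require Import all_classical all_reals all_analysis.
From mathcomp Require Import measurable_realfun lra ring.
Import Order.TTheory GRing.Theory Num.Theory.
Import numFieldNormedType.Exports.
Local Open Scope classical_set_scope.
Local Open Scope ring_scope.

Set Implicit Arguments.
Unset Strict Implicit.
Unset Printing Implicit Defensive.

(** * Asynchronous contractions *)

Lemma divergent_sum_large (R : realType) (a : nat -> R) (N : nat) (B : R) :
  (forall t, 0 <= a t) -> (\sum_(t <oo) (a t)%:E = +oo)%E ->
  \forall n \near \oo, B <= \sum_(N <= i < n) a i.
Proof.
move=> a0 aoo.
have : (fun n => \sum_(0 <= i < n) (a i)%:E)%E @ \oo --> (+oo : \bar R)%E.
  rewrite -aoo; apply: is_cvg_nneseries => n _ _; by rewrite lee_fin.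
move/cvgeyPge => /(_ (B + \sum_(0 <= i < N) a i)) aB.
near=> n.
have : ((B + \sum_(0 <= i < N) a i)%:E <= \sum_(0 <= i < n) (a i)%:E)%E.
  by near: n.
rewrite sumEFin lee_fin => h.
have Nn : (N <= n)%N by near: n; exact: nbhs_infty_ge.
by rewrite -(@lerD2r _ (\sum_(0 <= i < N) a i)) addrC [leRHS]addrC
  -big_cat_nat//= addrC.
Unshelve. all: by end_near. Qed.

(** Each step multiplies the excess [x t - b], up to an upper bound, by [1 - a t <= expR (- a t)].
    From time [N] on, the excess is thus at most [|x N - b|] times the exponential of minus the sum
    of the rates, and that sum diverges. *)
Lemma averaging_eventually_le (R : realType) (a x : nat -> R) (b : R)
    (N : nat) :
  (forall t, 0 <= a t <= 1) -> (\sum_(t <oo) (a t)%:E = +oo)%E ->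
  (forall t, (N <= t)%N -> x t.+1 <= (1 - a t) * x t + a t * b) ->
  forall e, 0 < e -> \forall t \near \oo, x t <= b + e.
Proof.
move=> a01 aoo xS e e0.
have a0 t : 0 <= a t by case/andP: (a01 t).
pose C := `|x N - b|.
have xE n : (N <= n)%N -> x n - b <= expR (- \sum_(N <= i < n) a i) * C.
  move=> /subnK <-; elim: (n - N)%N => [|k IH].
    by rewrite add0n big_geq// oppr0 expR0 mul1r ler_norm.
  have Nk : (N <= k + N)%N by rewrite leq_addl.
  rewrite addSn big_nat_recr//= opprD expRD.
  have [_ a1] := andP (a01 (k + N)%N).
  apply: (@le_trans _ _ ((1 - a (k + N)%N) * (x (k + N)%N - b))).
    by have := xS _ Nk; lra.
  apply: (le_trans (ler_wpM2l _ IH)); first by rewrite subr_ge0.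
  rewrite mulrA ler_wpM2r ?normr_ge0// [leRHS]mulrC ler_wpM2r ?expR_ge0//.
  by have := expR_ge1Dx (- a (k + N)%N).
near=> n.
have Nn : (N <= n)%N by near: n; exact: nbhs_infty_ge.
have hB : C / e <= \sum_(N <= i < n) a i.
  by near: n; exact: divergent_sum_large.
rewrite -lerBlDl; apply: (le_trans (xE _ Nn)).
have C0 : 0 <= C by exact: normr_ge0.
rewrite expRN mulrC ler_pdivrMr ?expR_gt0//.
apply: (@le_trans _ _ (e * (1 + C / e))).
  by rewrite mulrDr mulr1 mulrCA mulfV ?gt_eqF// mulr1 lerDr ltW.
rewrite ler_wpM2l//; first exact: ltW.
by apply: le_trans (expR_ge1Dx _) _; rewrite ler_expR.
Unshelve. all: by end_near. Qed.

(** The bound on the error improves geometrically: once all coordinates are below [B] and [c] is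
    small, each one is averaged towards almost [gamma * B] and eventually falls below [q * B], with
    [q] halfway between [gamma] and 1. The coordinates do so at different times, but there are
    finitely many of them. *)
Lemma asynchronous_contraction_cvg0 (R : realType) (I : finType)
    (D a : nat -> I -> R) (c : nat -> R) (gamma : R) :
  0 <= gamma < 1 ->
  (forall t i, 0 <= a t i <= 1) ->
  (forall i, \sum_(t <oo) (a t i)%:E = +oo)%E ->
  c @ \oo --> (0 : R) ->
  (forall t i B, (forall j, `|D t j| <= B) ->
     `|D t.+1 i| <= (1 - a t i) * `|D t i| + a t i * (gamma * B + c t)) ->
  forall i, D ^~ i @ \oo --> (0 : R).
Proof.
move=> /andP[g0 g1] a01 aoo c0 DS.
have bounded : exists2 B, 0 < B & forall t i, `|D t i| <= B.
  have [C [C0 CB]] : exists C, 0 <= C /\ forall t, c t <= C.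
    have [C [_ HC]] := cvg_seq_bounded (cvgP _ c0).
    exists (`|C| + 1); split; first by rewrite addr_ge0.
    move=> t; apply: le_trans (ler_norm _) _.
    by apply: HC => //; rewrite (le_lt_trans (ler_norm C))// ltrDl.
  (* The first summand gives [gamma * B0 + C <= B0], so the bound [B0] propagates in time; the
     second covers the initial values and the 1 makes [B0] positive. *)
  pose B0 := C / (1 - gamma) + \sum_i `|D 0%N i| + 1.
  have S0 : 0 <= \sum_i `|D 0%N i| by apply: sumr_ge0.
  have C1 : 0 <= C / (1 - gamma) by rewrite divr_ge0// subr_ge0 ltW.
  have gB : gamma * B0 + C <= B0.
    suff : C <= (1 - gamma) * B0 by lra.
    rewrite mulrC -ler_pdivrMr ?subr_gt0// /B0; lra.
  exists B0; first by rewrite /B0; lra.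
  elim=> [|t IH] i.
    have : `|D 0%N i| <= \sum_i `|D 0%N i|.
      by rewrite (bigD1 i)//= lerDl sumr_ge0.
    by rewrite /B0; lra.
  apply: le_trans (DS _ _ _ IH) _.
  have /andP[ai0 ai1] := a01 t i.
  apply: (@le_trans _ _ ((1 - a t i) * B0 + a t i * B0)); last by lra.
  apply: lerD; first by rewrite ler_wpM2l ?subr_ge0.
  rewrite ler_wpM2l//; apply: le_trans gB; by rewrite lerD2l.
have [B0 B00 DB0] := bounded.
pose q := (1 + gamma) / 2.
have q0 : 0 <= q by rewrite /q; lra.
have q1 : q < 1 by rewrite /q; lra.
have step k : \forall t \near \oo, forall i, `|D t i| <= q ^+ k * B0.
  elim: k => [|k IH]; first by near=> t => i; rewrite expr0 mul1r.
  pose B := q ^+ k * B0; rewrite exprS -mulrA -/B.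
  have [B0'|Bn0] := eqVneq B 0.
    by rewrite B0' mulr0; move: IH; rewrite -/B B0'.
  have Bpos : 0 < B.
    by rewrite lt0r Bn0/= mulr_ge0 ?exprn_ge0// ltW.
  (* Chosen so that [gamma * B + e + e = q * B]: one [e] bounds the perturbation, the other is the
     slack of the averaging lemma. *)
  pose e := (1 - gamma) / 4 * B.
  have e0 : 0 < e by rewrite mulr_gt0// divr_gt0// subr_gt0.
  have ce : \forall t \near \oo, c t <= e.
    near=> t; apply: le_trans (ler_norm _) _; near: t.
    exact: cvgr0_norm_le.
  have [N _ HN] := filterI IH ce.
  apply: filter_forall => i.
  have := @averaging_eventually_le _ (a ^~ i) (fun t => `|D t i|)
    (gamma * B + e) N (a01 ^~ i) (aoo i) _ _ e0.
  have -> : gamma * B + e + e = q * B by rewrite /e /q; field.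
  apply=> t Nt; have [DB cte] := HN t Nt.
  apply: (le_trans (DS t i B DB)); rewrite lerD2l ler_wpM2l ?lerD2l//.
  by case/andP: (a01 t i).
move=> i; apply/cvgr0Pnorm_le => e e0.
have : (fun k => q ^+ k * B0) @ \oo --> (0 : R).
  rewrite -[X in _ --> X](mul0r B0); apply: cvgM; last exact: cvg_cst.
  by apply: cvg_expr; rewrite ger0_norm.
move=> /cvgr0Pnorm_le /(_ _ e0) [k _ /(_ k (leqnn k)) /= qk].
have := step k; apply: filterS => t /(_ i) /le_trans; apply.
exact: le_trans (ler_norm _) qk.
Unshelve. all: by end_near. Qed.

(** * Convergence along a sample path *)

(** The maximum is nonexpansive for the sup norm, and [f b] is the maximum of [f]. Any maximiser [b]
    will do, so the bound is independent of the tie-breaking rule. *)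
Lemma fmax_near_argmax (R : realType) (A : finType) (a0 b : A) (f h : A -> R)
    (C : R) :
  (forall a, f a <= f b) -> (forall a, `|f a - h a| <= C) ->
  `|f b - fmax a0 h| <= C.
Proof.
move=> fb fh; rewrite ler_norml; apply/andP; split.
  suff : fmax a0 h <= f b + C by lra.
  apply/bigmax_leP; split=> [|a _].
    by have := fb a0; have := fh a0; rewrite ler_norml => /andP[]; lra.
  by have := fb a; have := fh a; rewrite ler_norml => /andP[]; lra.
have : h b <= fmax a0 h by exact: le_bigmax.
by have := fh b; rewrite ler_norml => /andP[]; lra.
Qed.

Lemma cvg_sum0 (R : realType) (I : finType) (f : nat -> I -> R) :
  (forall i, f ^~ i @ \oo --> (0 : R)) ->
  (fun t => \sum_i `|f t i|) @ \oo --> (0 : R).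
Proof.
move=> f0.
rewrite [in X in _ --> X](_ : 0 = \sum_(i : I) `|(0 : R)|); last first.
  by rewrite big1// => i _; rewrite normr0.
apply: (@cvg_big _ _ +%R) => [|i _]; first exact: add_continuous.
exact: cvg_norm.
Qed.

Lemma series_tail_cvg0 (R : realType) (u : nat -> R) : cvgn (series u) ->
  (fun t => limn (series u) - series u t) @ \oo --> (0 : R).
Proof.
move=> cu; rewrite -(subrr (limn (series u))).
by apply: cvgB; [exact: cvg_cst|exact: cu].
Qed.

(* The tails of the noise series are added to the error [Q TA - Qstar]: this
   turns the noisy recursion into a deterministic contraction with vanishing
   perturbation. *)
Lemma ctq_cvg_path (R : realType) (S A : finType) (a0 : A) (gamma : R)
    (Qstar : S -> A -> R) (g : R -> R -> R -> R) (amax : S -> (A -> R) -> A)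
    (Q0 : tbl -> S -> A -> R) (s_ : nat -> S) (a_ : nat -> A) (r_ : nat -> R)
    (alpha : nat -> S -> A -> R) :
  0 <= gamma < 1 ->
  (forall x y z, `|g x y z - x| <= `|y - x| + `|z - x|) ->
  (forall s (f : A -> R) a, f a <= f (amax s f)) ->
  (forall t s a, 0 <= alpha t s a <= 1) ->
  (forall t s a, (s, a) <> (s_ t, a_ t) -> alpha t s a = 0) ->
  (forall s a, \sum_(t <oo) (alpha t s a)%:E = +oo)%E ->
  (forall s a, cvgn (series (fun t => alpha t s a *
     (r_ t + gamma * fmax a0 (Qstar (s_ t.+1)) - Qstar s a)))) ->
  forall X s a,
    (fun t => ctq gamma g amax Q0 s_ a_ r_ alpha t X s a) @ \oo --> Qstar s a.
Proof.
move=> g01 gx amaxP al01 al0 aloo cvgN.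
have [g0 g1] := andP g01.
pose Q t := ctq gamma g amax Q0 s_ a_ r_ alpha t.
pose b t := amax (s_ t.+1) (Q t TA (s_ t.+1)).
pose G t := g (Q t TA (s_ t.+1) (b t)) (Q t TB (s_ t.+1) (b t))
              (Q t TC (s_ t.+1) (b t)).
(* The rate is zero away from the visited pair, so one formula covers both branches of the
   update. *)
have QS t X s a : Q t.+1 X s a =
    Q t X s a + alpha t s a * (r_ t + gamma * G t - Q t X s a).
  rewrite /Q /= /ctq_step /=; case: ifPn => // /negP ne.
  rewrite al0 ?mul0r ?addr0//.
  by move=> [ss aa]; apply: ne; rewrite ss aa !eqxx.
pose al t (i : S * A) := alpha t i.1 i.2.
have al01' t i : 0 <= al t i <= 1 by exact: al01.
have aloo' i : (\sum_(t <oo) (al t i)%:E = +oo)%E by exact: aloo.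
pose df X t (i : S * A) := Q t X i.1 i.2 - Q t TA i.1 i.2.
have df0 X i : df X ^~ i @ \oo --> (0 : R).
  (* The common target cancels in the difference of two tables: this is a contraction with factor 0
     and no perturbation. *)
  apply: (@asynchronous_contraction_cvg0 _ _ (df X) al (fun=> 0) 0).
  - by rewrite lexx ltr01.
  - exact: al01'.
  - exact: aloo'.
  - exact: cvg_cst.
  - move=> t {}i B _; rewrite mul0r addr0 mulr0 addr0.
    have -> : df X t.+1 i = (1 - al t i) * df X t i.
      by rewrite /df !QS /al; ring.
    have /andP[_ h] := al01' t i.
    by rewrite normrM ger0_norm// subr_ge0.
pose e t := \sum_i `|df TB t i| + \sum_i `|df TC t i|.
have e0 : e @ \oo --> (0 : R).
  rewrite -[X in _ --> X]addr0.
  by apply: cvgD; apply: cvg_sum0 => i; exact: df0.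
pose N (i : S * A) t := alpha t i.1 i.2 *
  (r_ t + gamma * fmax a0 (Qstar (s_ t.+1)) - Qstar i.1 i.2).
pose T t i := limn (series (N i)) - series (N i) t.
have T0 i : T ^~ i @ \oo --> (0 : R) by apply: series_tail_cvg0; exact: cvgN.
have TS t i : T t.+1 i = T t i - N i t.
  by rewrite /T !seriesEnat/= big_nat_recr//=; ring.
(* The tails count twice: once for the term [T t i] in the recursion of [D], once because
   [Q t TA - Qstar] differs from [D] by a tail. *)
pose c t := \sum_i `|T t i| + \sum_i `|T t i| + e t.
have c0 : c @ \oo --> (0 : R).
  rewrite -[X in _ --> X]addr0; apply: cvgD; last exact: e0.
  by rewrite -[X in _ --> X]addr0; apply: cvgD; apply: cvg_sum0.
have Tle t i : `|T t i| <= \sum_j `|T t j|.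
  by rewrite (bigD1 i)//= lerDl sumr_ge0.
pose D t i := Q t TA i.1 i.2 - Qstar i.1 i.2 + T t i.
have D0 i : D ^~ i @ \oo --> (0 : R).
  apply: (@asynchronous_contraction_cvg0 _ _ D al c gamma) => // t {}i B DB.
  have -> : D t.+1 i = (1 - al t i) * D t i + al t i *
      (T t i + gamma * (G t - fmax a0 (Qstar (s_ t.+1)))).
    by rewrite /D TS QS /N /al; ring.
  have /andP[h0 h1] := al01' t i.
  apply: le_trans (ler_normD _ _) _; rewrite !normrM.
  rewrite (ger0_norm h0) ger0_norm ?subr_ge0// lerD2l ler_wpM2l//.
  apply: le_trans (ler_normD _ _) _; rewrite normrM (ger0_norm g0).
  have Ge : `|G t - Q t TA (s_ t.+1) (b t)| <= e t.
    apply: le_trans (gx _ _ _) _; apply: lerD.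
      by rewrite (bigD1 (s_ t.+1, b t))//= lerDl sumr_ge0.
    by rewrite (bigD1 (s_ t.+1, b t))//= lerDl sumr_ge0.
  have Qe : `|Q t TA (s_ t.+1) (b t) - fmax a0 (Qstar (s_ t.+1))|
      <= B + \sum_j `|T t j|.
    apply: fmax_near_argmax => [a|a]; first exact: amaxP.
    have -> : Q t TA (s_ t.+1) a - Qstar (s_ t.+1) a =
      D t (s_ t.+1, a) - T t (s_ t.+1, a) by rewrite /D /=; ring.
    by apply: le_trans (ler_normB _ _) _; exact: lerD.
  have GV : `|G t - fmax a0 (Qstar (s_ t.+1))| <= B + \sum_j `|T t j| + e t.
    rewrite [leRHS]addrC; apply: le_trans (lerD Ge Qe).
    by apply: le_trans _ (ler_normD _ _); rewrite addrA subrK.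
  have Te0 : 0 <= \sum_j `|T t j| + e t.
    by rewrite addr_ge0 ?addr_ge0 ?sumr_ge0.
  have gTe : gamma * (\sum_j `|T t j| + e t) <= \sum_j `|T t j| + e t.
    by rewrite ler_piMl// ltW.
  have := ler_wpM2l g0 GV; have := Tle t i; rewrite /c; lra.
have QA s a : (fun t => Q t TA s a) @ \oo --> Qstar s a.
  have -> : (fun t => Q t TA s a) =
    (fun t => D t (s, a) - T t (s, a) + Qstar s a).
    by apply/funext => t; rewrite /D /=; ring.
  rewrite -[X in _ --> X]add0r -[in X in _ --> X](subr0 0).
  apply: cvgD; last exact: cvg_cst.
  by apply: cvgB; [exact: D0|exact: T0].
move=> X s a; rewrite -/Q.
have -> : (fun t => ctq gamma g amax Q0 s_ a_ r_ alpha t X s a) =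
  (fun t => Q t TA s a + df X t (s, a)).
  by apply/funext => t; rewrite /df /= addrC subrK.
by rewrite -[Qstar s a]addr0; apply: cvgD; [exact: QA|exact: df0].
Qed.

(** The value lies between the least and the greatest argument. The path argument uses the target
    mapping only through this bound, which holds for the median for the same reason. *)
Lemma mean_two_smallest_near (R : realType) (x y z : R) :
  `|mean_two_smallest x y z - x| <= `|y - x| + `|z - x|.
Proof.
rewrite /mean_two_smallest /Num.max; do ! case: ifPn;
  rewrite -?leNgt => *; case: (ler0P (y - x)); case: (ler0P (z - x)) => *;
  rewrite ler_norml; apply/andP; split; lra.
Qed.

Lemma median3_near (R : realType) (x y z : R) :
  `|median3 x y z - x| <= `|y - x| + `|z - x|.
Proof.
rewrite /median3 /Num.max /Num.min; do ! case: ifPn;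
  rewrite -?leNgt => *; case: (ler0P (y - x)); case: (ler0P (z - x)) => *;
  rewrite ler_norml; apply/andP; split; lra.
Qed.

(** * Sampling from a conditional law *)

Lemma square_integrable_integrable (d : measure_display) (T : measurableType d)
    (R : realType) (mu : {finite_measure set T -> \bar R}) (f : T -> R) :
  measurable_fun setT f -> mu.-integrable setT (fun x => (f x ^+ 2)%:E) ->
  mu.-integrable setT (EFin \o f).
Proof.
move=> mf f2.
apply: (@le_integrable _ _ _ _ _ _ _ (fun x => (1 + f x ^+ 2)%:E)) => //.
- exact/measurable_EFinP.
- move=> x _; rewrite /= lee_fin (ger0_norm (_ : 0 <= 1 + f x ^+ 2)); last first.
    by rewrite addr_ge0// sqr_ge0.
  rewrite ler_norml; apply/andP; split; nra.
- under eq_fun do rewrite EFinD; apply: integrableD => //.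
  exact: finite_measure_integrable_cst.
Qed.

Section integral_mrestr.
Context d (T : measurableType d) (R : realType).
Variables (mu : {measure set T -> \bar R}) (F : set T) (mF : measurable F).

(** Restricting the measure to [F] turns a sampling law that holds only on [F] into an unconditional
    one; integrands vanishing off [F] do not notice. *)
Lemma integral_mrestr (f : T -> \bar R) : (forall w, ~ F w -> f w = 0%E) ->
  (\int[mrestr mu mF]_w f w = \int[mu]_w f w)%E.
Proof.
move=> f0; have fF : f \_ F = f.
  apply/funext => w; rewrite patchE; case: ifPn => // /negP wF.
  by rewrite f0// => Fw; apply: wF; rewrite inE.
rewrite -fF -!integral_mkcond; apply: eq_measure_integral => E mE EF.
by rewrite /= /mrestr; congr (mu _); exact/setIidl.
Qed.

Lemma integrable_mrestr (f : T -> \bar R) : (forall w, ~ F w -> f w = 0%E) ->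
  mu.-integrable setT f -> (mrestr mu mF).-integrable setT f.
Proof.
move=> f0 /integrableP[mf fi]; apply/integrableP; split=> //.
by rewrite integral_mrestr// => w /f0 ->; rewrite abse0.
Qed.

End integral_mrestr.

(** The pushforward under a name of its own, on which a finite measure structure can be declared;
    bundling [Z] as a measurable function supplies the proof that this needs. *)
Definition finite_law d d' (T : measurableType d) (U : measurableType d')
    (R : realType) (mu : set T -> \bar R) (Z : {mfun T >-> U}) :=
  pushforward mu Z.

Section finite_law.
Context d d' (T : measurableType d) (U : measurableType d') (R : realType).
Variables (mu : {finite_measure set T -> \bar R}) (Z : {mfun T >-> U}).

Let law0 : finite_law mu Z set0 = 0%E. Proof. exact: measure0. Qed.

Let law_ge0 A : (0 <= finite_law mu Z A)%E. Proof. exact: measure_ge0. Qed.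

Let law_sigma_additive : semi_sigma_additive (finite_law mu Z).
Proof. exact: measure_semi_sigma_additive. Qed.

HB.instance Definition _ := isMeasure.Build _ _ _ (finite_law mu Z)
  law0 law_ge0 law_sigma_additive.

Let law_fin_num : fin_num_fun (finite_law mu Z).
Proof.
move=> E mE; rewrite /finite_law /pushforward fin_num_measure//.
by rewrite -[_ @^-1` _]setTI; exact: measurable_funP.
Qed.

HB.instance Definition _ :=
  Measure_isFinite.Build _ _ _ (finite_law mu Z) law_fin_num.

End finite_law.

(* [F] is the event on which [X] is sampled from [nu] independently of the
   sub-sigma-algebra generated by [G]. *)
Section sampling.
Context d d1 d2 (T : measurableType d) (U : measurableType d1)
  (V : measurableType d2) (R : realType).
Variables (P : probability T R) (G : set (set T)) (F : set T) (X : T -> V)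
  (nu : probability V R).
Hypotheses (GT : forall E, <<s G >> E -> measurable E) (GF : <<s G >> F)
  (mX : measurable_fun setT X).
Hypothesis XP : forall E B, <<s G >> E -> measurable B ->
  P (E `&` (F `&` X @^-1` B)) = (nu B * P (E `&` F))%E.

Lemma measurable_sub_sigma (Z : g_sigma_algebraType G -> U) :
  measurable_fun setT Z -> measurable_fun setT (Z : T -> U).
Proof. by move=> mZ _ B mB; apply: GT; exact: mZ. Qed.

Section joint_law.
Variable Z : g_sigma_algebraType G -> U.
Hypothesis mZ : measurable_fun setT Z.

Let mF : measurable F. Proof. exact: GT. Qed.
Let mZT : measurable_fun setT (Z : T -> U).
Proof. exact: measurable_sub_sigma. Qed.
Let Z' : {mfun T >-> U} :=
  HB.pack (Z : T -> U) (isMeasurableFun.Build _ _ _ _ _ mZT).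
Let mZX : measurable_fun setT (fun w : T => (Z w, X w)).
Proof. exact/measurable_fun_pair. Qed.
Let ZX : {mfun T >-> (U * V)%type} := HB.pack (fun w : T => (Z w, X w))
  (isMeasurableFun.Build _ _ _ _ _ mZX).

Let lawZ : {finite_measure set U -> \bar R} := finite_law (mrestr P mF) Z'.

Let joint E : measurable E ->
  (lawZ \x nu)%E E = pushforward (mrestr P mF) ZX E.
Proof.
(* A product measure is determined by its values on rectangles, and there the identity is [XP] for
   the event that [Z] lies in [A]. *)
move=> mE; apply: product_measure_unique => // A B mA mB.
rewrite /lawZ /finite_law /pushforward /= /mrestr /= muleC -XP//; last first.
  by rewrite -[_ @^-1` _]setTI; exact: mZ.
by congr (P _); apply/seteqP; split=> w /=; tauto.
Qed.

Let ge0_integral_joint (f : U * V -> \bar R) :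
  measurable_fun setT f -> (forall z, 0 <= f z)%E ->
  (forall w, ~ F w -> f (Z w, X w) = 0)%E ->
  (\int[P]_w f (Z w, X w) = \int[lawZ \x nu]_z f z)%E.
Proof.
move=> mf f0 fF; rewrite -(integral_mrestr P mF)//.
transitivity (\int[pushforward (mrestr P mF) ZX]_z f z)%E.
  by rewrite ge0_integral_pushforward.
by apply: eq_measure_integral => E mE _; exact/esym/joint.
Qed.

Let integral_joint (f : U * V -> \bar R) :
  measurable_fun setT f -> P.-integrable setT (fun w => f (Z w, X w)) ->
  (forall w, ~ F w -> f (Z w, X w) = 0)%E ->
  (\int[P]_w f (Z w, X w) = \int[lawZ]_z \int[nu]_v f (z, v))%E.
Proof.
move=> mf fi fF.
have fi' : (lawZ \x nu)%E.-integrable setT f.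
  apply/integrableP; split=> //; rewrite -(ge0_integral_joint (f := abse \o f)).
  - by case/integrableP : fi.
  - exact: measurableT_comp.
  - by move=> z; exact: abse_ge0.
  - by move=> w /fF /= ->; rewrite abse0.
rewrite [RHS](integral12_prod_meas1 fi') -(integral_mrestr P mF)//.
transitivity (\int[pushforward (mrestr P mF) ZX]_z f z)%E.
  by rewrite integral_pushforward//; exact: integrable_mrestr.
by apply: eq_measure_integral => E mE _; exact/esym/joint.
Qed.

(** Restricted to [F], the pair [(Z, X)] has a product law with second factor [nu]; the first factor
    is the law of [Z] restricted to [F]. The two clauses are the Tonelli and Fubini forms of this
    independence. *)
Lemma sampling_joint_law : exists m : {finite_measure set U -> \bar R},
  (forall f : U * V -> \bar R, measurable_fun setT f ->
     (forall z, 0 <= f z)%E -> (forall w, ~ F w -> f (Z w, X w) = 0)%E ->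
     (\int[P]_w f (Z w, X w) = \int[m \x nu]_z f z)%E) /\
  (forall f : U * V -> \bar R, measurable_fun setT f ->
     P.-integrable setT (fun w => f (Z w, X w)) ->
     (forall w, ~ F w -> f (Z w, X w) = 0)%E ->
     (\int[P]_w f (Z w, X w) = \int[m]_z \int[nu]_v f (z, v))%E).
Proof.
by exists lawZ; split=> f; [exact: ge0_integral_joint|exact: integral_joint].
Qed.

End joint_law.
End sampling.

Section sampled_product.
Context d d2 (T : measurableType d) (V : measurableType d2) (R : realType).
Variables (P : probability T R) (G : set (set T)) (F : set T) (X : T -> V)
  (nu : probability V R).
Hypotheses (GT : forall E, <<s G >> E -> measurable E) (GF : <<s G >> F)
  (mX : measurable_fun setT X).
Hypothesis XP : forall E B, <<s G >> E -> measurable B ->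
  P (E `&` (F `&` X @^-1` B)) = (nu B * P (E `&` F))%E.
Variables (Z : g_sigma_algebraType G -> R) (h : V -> R).
Hypotheses (mZ : measurable_fun setT Z) (ZF : forall w, ~ F w -> Z w = 0)
  (mh : measurable_fun setT h).

Lemma integral_normM_sampling :
  (\int[P]_w `|Z w * h (X w)|%:E =
   \int[P]_w `|Z w|%:E * \int[nu]_v `|h v|%:E)%E.
Proof.
have [m [mE _]] := sampling_joint_law GT GF mX XP mZ.
have main (k : V -> R) : measurable_fun setT k ->
    (\int[P]_w (`|Z w| * `|k (X w)|)%:E =
    \int[m]_z `|z|%:E * \int[nu]_v `|k v|%:E)%E.
  move=> mk; pose f (z : R * V) := (`|z.1| * `|k z.2|)%:E.
  have mf : measurable_fun setT f.
    apply/measurable_EFinP; apply: measurable_funM.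
      by apply: measurableT_comp.
    by do 2 apply: measurableT_comp => //.
  rewrite [LHS](mE f)//; last first.
  - by move=> w /ZF; rewrite /f /= => ->; rewrite normr0 mul0r.
  - by move=> z; rewrite /f lee_fin mulr_ge0.
  rewrite fubini_tonelli1// /fubini_F /f /=; last first.
    by move=> z; rewrite lee_fin mulr_ge0.
  rewrite -ge0_integralZr//=.
  - apply: eq_integral => z _; under eq_integral do rewrite EFinM.
    rewrite ge0_integralZl//.
    by apply/measurable_EFinP; apply: measurableT_comp.
  - by apply/measurable_EFinP; exact: normr_measurable.
  - by apply: integral_ge0.
under eq_integral do rewrite normrM.
rewrite main//; congr (_ * _)%E.
(* The constant function 1 identifies the integral of [|z|] under [m] with that of [|Z|] under
   [P]. *)
have := main (cst 1) (measurable_cst _); rewrite /= normr1.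
under eq_integral do rewrite mulr1.
by rewrite integral_cst//= probability_setT !mule1.
Qed.

Lemma ge0_integralM_sampling : (forall w, 0 <= Z w) -> (forall v, 0 <= h v) ->
  (\int[P]_w (Z w * h (X w))%:E =
   \int[P]_w (Z w)%:E * \int[nu]_v (h v)%:E)%E.
Proof.
move=> Z0 h0; have := integral_normM_sampling.
rewrite (_ : (fun w => `|Z w * h (X w)|%:E) = (fun w => (Z w * h (X w))%:E));
  last by apply/funext => w; rewrite ger0_norm ?mulr_ge0.
rewrite (_ : (fun w => `|Z w|%:E) = (fun w => (Z w)%:E));
  last by apply/funext => w; rewrite ger0_norm.
rewrite (_ : (fun v => `|h v|%:E) = (fun v => (h v)%:E))//.
by apply/funext => v; rewrite ger0_norm.
Qed.

Lemma integrableM_sampling : P.-integrable setT (EFin \o (Z : T -> R)) ->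
  nu.-integrable setT (EFin \o h) ->
  P.-integrable setT (fun w => (Z w * h (X w))%:E).
Proof.
move=> /integrableP[_ Zi] /integrableP[_ hi]; apply/integrableP; split.
  apply/measurable_EFinP/measurable_funM.
    exact: (measurable_sub_sigma GT).
  exact: measurableT_comp.
rewrite [ltLHS](integral_normM_sampling) lte_mul_pinfty//.
- exact: integral_ge0.
- by rewrite ge0_fin_numE// integral_ge0.
Qed.

(** For fixed [z] the integral over the sample is [z] times the mean of [h], hence 0. This is the
    martingale difference property, expressed without conditional expectations. *)
Lemma integralM_sampling0 : P.-integrable setT (EFin \o (Z : T -> R)) ->
  nu.-integrable setT (EFin \o h) -> (\int[nu]_v (h v)%:E = 0)%E ->
  (\int[P]_w (Z w * h (X w))%:E = 0)%E.
Proof.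
move=> Zi hi h0; pose f (z : R * V) := (z.1 * h z.2)%:E.
have [m [_ mE]] := sampling_joint_law GT GF mX XP mZ.
rewrite [LHS](mE f).
- apply: integral0_eq => z _; rewrite /f /=.
  by under eq_integral do rewrite EFinM; rewrite integralZl// h0 mule0.
- apply/measurable_EFinP; apply: measurable_funM => //.
  exact: measurableT_comp.
- exact: integrableM_sampling.
- by move=> w /ZF; rewrite /f /= => ->; rewrite mul0r.
Qed.

End sampled_product.

(** * Martingale transforms *)

Lemma measurable_sub_sigma_le (T : pointedType) d' (U : measurableType d')
    (G H : set (set T)) (Z : T -> U) : <<s G >> `<=` <<s H >> ->
  measurable_fun [set: g_sigma_algebraType G] Z ->
  measurable_fun [set: g_sigma_algebraType H] Z.
Proof. by move=> GH mZ _ B mB; apply: GH; exact: mZ. Qed.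

Definition second_moment (d : measure_display) (V : measurableType d)
    (R : realType) (nu : set V -> \bar R) (h : V -> R) : R :=
  fine (\int[nu]_v (h v ^+ 2)%:E)%E.

Section martingale.
Context d d2 (T : measurableType d) (V : measurableType d2) (R : realType).
Variables (P : probability T R) (G : nat -> set (set T)) (F : nat -> set T)
  (X : nat -> T -> V) (nu : probability V R) (h : V -> R).
Hypotheses (GT : forall n E, <<s G n >> E -> measurable E)
  (GS : forall n, <<s G n >> `<=` <<s G n.+1 >>)
  (GF : forall n, <<s G n >> (F n))
  (GX : forall n, measurable_fun [set: g_sigma_algebraType (G n.+1)] (X n)).
Hypothesis XP : forall n E B, <<s G n >> E -> measurable B ->
  P (E `&` (F n `&` X n @^-1` B)) = (nu B * P (E `&` F n))%E.
Hypotheses (mh : measurable_fun setT h)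
  (h2 : nu.-integrable setT (fun v => (h v ^+ 2)%:E))
  (h0 : (\int[nu]_v (h v)%:E = 0)%E).

Local Notation var := (second_moment nu h).

(** The weight [c n] is known before [X n] is drawn, and it vanishes off [F n] because the law of
    [X n] is prescribed only there. The uniform bound keeps second moments finite. *)
Definition predictable (c : nat -> T -> R) :=
  [/\ forall n, measurable_fun [set: g_sigma_algebraType (G n)] (c n),
      forall n w, ~ F n w -> c n w = 0 &
      exists B : R, forall n w, `|c n w| <= B].

Definition transform (c : nat -> T -> R) (n : nat) (w : T) : R :=
  \sum_(i < n) c i w * h (X i w).

Let mX n : measurable_fun setT (X n).
Proof. exact: (measurable_sub_sigma (@GT n.+1)). Qed.

Let G_le m n : (m <= n)%N -> <<s G m >> `<=` <<s G n >>.
Proof.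
move/subnK <-; elim: (n - m)%N => [//|k IH].
by rewrite addSn => E /IH; exact: GS.
Qed.

Let var_ge0 : 0 <= var.
Proof.
by rewrite fine_ge0// integral_ge0// => v _; rewrite lee_fin sqr_ge0.
Qed.

Let varE : (\int[nu]_v (h v ^+ 2)%:E)%E = var%:E.
Proof. by rewrite /second_moment fineK// integrable_fin_num. Qed.

Let hi : nu.-integrable setT (EFin \o h).
Proof. exact: square_integrable_integrable. Qed.

Lemma measurable_transform (c : nat -> T -> R) n : predictable c ->
  measurable_fun [set: g_sigma_algebraType (G n)] (transform c n).
Proof.
move=> [mc _ _].
apply: (@measurable_sum _ (g_sigma_algebraType (G n)) R setT 'I_n (index_enum _)
  (fun i w => c i w * h (X i w))) => i.
apply: measurable_funM.
  exact: (measurable_sub_sigma_le (G_le (ltnW (ltn_ord i))) (mc i)).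
apply: (measurableT_comp mh).
exact: (measurable_sub_sigma_le (G_le (ltn_ord i)) (@GX i)).
Qed.

(** Orthogonality of increments: in the square of a partial sum plus a new term, the cross term is
    [Z * h (X n)] with [Z] known at time [n], so its integral is 0, and the square of the new term
    contributes [var] times the integral of [c n ^+ 2]. *)
Lemma transform_second_moment (c : nat -> T -> R) n : predictable c ->
  P.-integrable setT (fun w => (transform c n w ^+ 2)%:E) /\
  (\int[P]_w (transform c n w ^+ 2)%:E =
   var%:E * \int[P]_w (\sum_(i < n) c i w ^+ 2)%:E)%E.
Proof.
move=> pc; have [mc cF [B cB]] := pc.
have B0 : 0 <= B by apply: le_trans (cB 0%N point).
have mcT i : measurable_fun setT (c i : T -> R).
  exact: (measurable_sub_sigma (@GT i)).
have c2i i : P.-integrable setT (fun w => (c i w ^+ 2)%:E).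
  apply: (@le_integrable _ _ _ _ _ _ _ (cst (B ^+ 2)%:E)) => //.
  - by apply/measurable_EFinP; exact: measurable_funX.
  - move=> w _; rewrite /= lee_fin !ger0_norm ?sqr_ge0//.
    by rewrite -(real_normK (num_real (c i w))) lerXn2r// nnegrE.
  - exact: finite_measure_integrable_cst.
elim: n => [|n [IHi IHE]].
  have t0 : (fun w => (transform c 0 w ^+ 2)%:E) = cst 0%E :> (T -> \bar R).
    by apply/funext => w; rewrite /transform big_ord0 expr0n.
  have s0 : (fun w => (\sum_(i < 0) c i w ^+ 2)%:E) = cst 0%E :> (T -> \bar R).
    by apply/funext => w; rewrite big_ord0.
  by rewrite t0 s0 integral0 mule0; split=> //; exact: integrable0.
pose Z w := 2 * c n w * transform c n w.
have mZ : measurable_fun [set: g_sigma_algebraType (G n)] Z.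
  apply: measurable_funM; last exact: measurable_transform.
  by apply: measurable_funM => //; exact: mc.
have Zi : P.-integrable setT (EFin \o Z).
  apply: (@le_integrable _ _ _ _ _ _ _
    (fun w => (2 * B * (1 + transform c n w ^+ 2))%:E)) => //.
  - by apply/measurable_EFinP; exact: (measurable_sub_sigma (@GT n)).
  - move=> w _; rewrite /= lee_fin /Z !normrM (ger0_norm B0) (ger0_norm (ler0n R 2)).
    rewrite -mulrA -[leRHS]mulrA ler_wpM2l// ler_pM//.
    rewrite (ger0_norm (_ : 0 <= 1 + _ ^+ 2)); last first.
      by rewrite addr_ge0// sqr_ge0.
    rewrite ler_norml; apply/andP; split; nra.
  - under eq_fun do rewrite EFinM; apply: integrableZl => //.
    under eq_fun do rewrite EFinD; apply: integrableD => //.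
    exact: finite_measure_integrable_cst.
have ZF w : ~ F n w -> Z w = 0.
  by move=> /cF; rewrite /Z => ->; rewrite mulr0 mul0r.
have mc2 :
    measurable_fun [set: g_sigma_algebraType (G n)] (fun w => c n w ^+ 2).
  by apply: measurable_funX; exact: mc.
have cF2 w : ~ F n w -> c n w ^+ 2 = 0 by move=> /cF ->; rewrite expr0n.
have mh2 : measurable_fun setT (fun v => h v ^+ 2) by exact: measurable_funX.
have Zhi := integrableM_sampling (@GT n) (@GF n) (@mX n) (@XP n) mZ ZF mh Zi hi.
have Zh0 := integralM_sampling0 (@GT n) (@GF n) (@mX n) (@XP n) mZ ZF mh Zi hi
  h0.
have chi := integrableM_sampling (@GT n) (@GF n) (@mX n) (@XP n) mc2 cF2 mh2
  (c2i n) h2.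
have chE : (\int[P]_w (c n w ^+ 2 * h (X n w) ^+ 2)%:E =
    var%:E * \int[P]_w (c n w ^+ 2)%:E)%E.
  rewrite (ge0_integralM_sampling (@GT n) (@GF n) (@mX n) (@XP n) mc2 cF2 mh2).
  - by rewrite varE muleC.
  - by move=> w; exact: sqr_ge0.
  - by move=> v; exact: sqr_ge0.
have sqE w : (transform c n.+1 w ^+ 2)%:E =
    ((transform c n w ^+ 2)%:E + (Z w * h (X n w))%:E +
     (c n w ^+ 2 * h (X n w) ^+ 2)%:E)%E.
  rewrite -!EFinD; congr EFin; rewrite /transform big_ord_recr/= /Z /transform.
  by ring.
have i12 : P.-integrable setT (fun w => (transform c n w ^+ 2)%:E +
    (Z w * h (X n w))%:E)%E by exact: integrableD.
split; first by under eq_fun do rewrite sqE; exact: integrableD.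
under eq_integral do rewrite sqE.
rewrite integralD// integralD// Zh0 adde0 IHE chE.
under [in RHS]eq_integral do rewrite big_ord_recr/= EFinD.
rewrite ge0_integralD//; first last.
- by apply/measurable_EFinP; exact: measurable_funX.
- by move=> w _; rewrite lee_fin sqr_ge0.
- by apply/measurable_EFinP/measurable_sum => i; exact: measurable_funX.
- by move=> w _; rewrite lee_fin sumr_ge0// => i _; rewrite sqr_ge0.
rewrite [RHS]ge0_muleDr//.
- apply: integral_ge0 => w _; rewrite lee_fin sumr_ge0// => i _.
  exact: sqr_ge0.
- by apply: integral_ge0 => w _; rewrite lee_fin sqr_ge0.
Qed.

Let measurable_transformT (c : nat -> T -> R) n : predictable c ->
  measurable_fun setT (transform c n).
Proof.
move=> pc; exact: (measurable_sub_sigma (@GT n) (measurable_transform pc)).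
Qed.

Let measurable_transform_ge (c : nat -> T -> R) n (eps : R) : predictable c ->
  measurable [set w | eps <= `|transform c n w|].
Proof.
move=> pc; rewrite [X in measurable X](_ : _ =
    setT `&` (fun w => `|transform c n w|) @^-1` `[eps, +oo[).
  apply: measurableT_comp => //; exact: measurable_transformT.
by apply/seteqP; split=> w /=; rewrite in_itv/= andbT => // -[].
Qed.

(* Kolmogorov's inequality: stopping the transform when it first reaches [eps]
   is again a transform, to which Chebyshev's inequality applies. *)
Lemma transform_maximal_inequality (c : nat -> T -> R) (eps : R) N :
  predictable c -> 0 < eps ->
  (P (\bigcup_(j in [set j | (j <= N)%N])
        [set w | (eps <= `|transform c j w|)%R])
   <= (var / eps ^+ 2)%:E * \int[P]_w (\sum_(i < N) c i w ^+ 2)%:E)%E.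
Proof.
move=> pc eps0; have [mc cF [B cB]] := pc.
(* The indicator that the level [eps] has not been reached up to time [n] inclusive. It depends only
   on the transform up to [n], so multiplying by it keeps the weights predictable. *)
pose theta n w : R :=
  \prod_(j < n.+1) (if `|transform c j w| < eps then 1 else 0).
have theta1 n w : (forall j, (j <= n)%N -> `|transform c j w| < eps) ->
    theta n w = 1.
  by move=> H; rewrite /theta big1// => j _; rewrite H// -ltnS.
have theta0 n w j : (j <= n)%N -> eps <= `|transform c j w| -> theta n w = 0.
  rewrite -ltnS => jn; rewrite leNgt => /negbTE H.
  by rewrite /theta (bigD1 (Ordinal jn))//= H mul0r.
have theta01 n w : theta n w = 0 \/ theta n w = 1.
  have [H|/existsNP[j /not_implyP[jn /negP]]] :=
    pselect (forall j, (j <= n)%N -> `|transform c j w| < eps).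
    by right; exact: theta1.
  by rewrite -leNgt => H; left; exact: theta0 H.
pose c' n w := theta n w * c n w.
have c'2 n w : c' n w ^+ 2 <= c n w ^+ 2.
  by rewrite /c'; have [->|->] := theta01 n w;
    rewrite ?mul0r ?mul1r// expr0n sqr_ge0.
have pc' : predictable c'.
  split=> [n|n w /cF|].
  - apply: measurable_funM; last exact: mc.
    apply: (@measurable_prod _ (g_sigma_algebraType (G n)) R setT 'I_n.+1
      (index_enum _)
      (fun j w => if `|transform c j w| < eps then 1 else 0)) => j _.
    apply: measurable_fun_ifT; [|exact: measurable_cst|exact: measurable_cst].
    apply: measurable_fun_ltr; last exact: measurable_cst.
    apply: (measurableT_comp (@normr_measurable R setT)).
    apply: (measurable_sub_sigma_le (G_le _) (measurable_transform pc)).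
    by rewrite -ltnS.
  - by rewrite /c' => ->; rewrite mulr0.
  - exists B => n w; apply: le_trans (cB n w).
    by rewrite /c'; have [->|->] := theta01 n w; rewrite ?mul0r ?mul1r ?normr0.
(* The stopped transform follows the original one up to and including the first time the level is
   reached, and is frozen from then on. *)
have stop w n : ((exists2 j, (j <= n)%N & eps <= `|transform c j w|) ->
      eps <= `|transform c' n w|) /\
    ((forall j, (j <= n)%N -> `|transform c j w| < eps) ->
      transform c' n w = transform c n w).
  elim: n => [|n [IH1 IH2]].
    split=> [[j]|_]; last by rewrite /transform !big_ord0.
    by rewrite leqn0 => /eqP ->; rewrite /transform !big_ord0.
  have tS : transform c' n.+1 w = transform c' n w + c' n w * h (X n w).
    by rewrite /transform big_ord_recr.
  have [H|/existsNP[j /not_implyP[jn /negP]]] :=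
    pselect (forall j, (j <= n)%N -> `|transform c j w| < eps).
    have tE : transform c' n.+1 w = transform c n.+1 w.
      by rewrite tS IH2// /c' theta1// mul1r /transform big_ord_recr.
    split=> [[j]|//]; rewrite tE leq_eqVlt => /predU1P[->//|jn] ej.
    by move: (H j jn); rewrite ltNge ej.
  rewrite -leNgt => ej; split=> [_|H].
    by rewrite tS /c' (theta0 _ _ _ jn ej) !mul0r addr0; apply: IH1; exists j.
  by have := H j (leqW jn); rewrite ltNge ej.
have [ci cE] := transform_second_moment N pc'.
apply: (@le_trans _ _ (P [set w | eps <= `|transform c' N w|])).
  apply: le_measure; rewrite ?inE.
  - by apply: bigcup_measurable => j _; exact: measurable_transform_ge.
  - exact: measurable_transform_ge.
  - by move=> w [j jN ej]; apply: (stop w N).1; exists j.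
apply: (@le_trans _ _ ((eps ^- 2)%:E *
    \int[P]_w (transform c' N w ^+ 2)%:E)%E).
  rewrite -(setIT [set w | _]) -integral_indic//; last first.
    exact: measurable_transform_ge.
  rewrite -ge0_integralZl//; first last.
  - by rewrite lee_fin invr_ge0 exprn_ge0// ltW.
  - by move=> w _; rewrite lee_fin sqr_ge0.
  - by case/integrableP : ci.
  apply: ge0_le_integral => //.
  - by apply/measurable_EFinP/measurable_indic; exact: measurable_transform_ge.
  - by apply: measurable_funeM; case/integrableP : ci.
  - move=> w _; rewrite -EFinM lee_fin indicE.
    case: (boolP (w \in _)) => [/set_mem /= ew|_].
      rewrite mulrC ler_pdivlMr ?exprn_gt0// mul1r.
      rewrite -(real_normK (num_real (transform c' N w))).
      by rewrite lerXn2r// nnegrE// ltW.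
    by rewrite mulr_ge0 ?sqr_ge0// invr_ge0 exprn_ge0// ltW.
rewrite cE muleA -EFinM (mulrC _ var); apply: lee_wpmul2l.
  by rewrite lee_fin divr_ge0// exprn_ge0// ltW.
apply: ge0_le_integral => //.
- by move=> w _; rewrite lee_fin sumr_ge0// => i _; rewrite sqr_ge0.
- apply/measurable_EFinP/measurable_sum => i; apply: measurable_funX.
  by have [mc' _ _] := pc'; exact: (measurable_sub_sigma (@GT i) (mc' i)).
- apply/measurable_EFinP/measurable_sum => i; apply: measurable_funX.
  exact: (measurable_sub_sigma (@GT i) (mc i)).
- by move=> w _; rewrite lee_fin ler_sum.
Qed.

(** The expected sums of squares [u] increase and are bounded by [K], so they converge. By the
    maximal inequality for the weights after time [m], the probability of a later oscillation of
    size [e] is at most [var / e ^+ 2] times the remainder of [u] after [m]. This tends to 0, so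
    almost every path is Cauchy. *)
Lemma transform_ae_cvg (c : nat -> T -> R) (K : R) : predictable c ->
  (forall n w, \sum_(i < n) c i w ^+ 2 <= K) ->
  \forall w \ae P, cvgn (fun n => transform c n w).
Proof.
move=> pc cK; have [mc cF [B cB]] := pc.
pose s n w : R := \sum_(i < n) c i w ^+ 2.
have s0 n w : 0 <= s n w by rewrite sumr_ge0// => i _; rewrite sqr_ge0.
have K0 : 0 <= K by exact: le_trans (s0 0%N point) (cK 0%N point).
have si n : P.-integrable setT (fun w => (s n w)%:E).
  apply: (@le_integrable _ _ _ _ _ _ _ (cst K%:E)) => //.
  - apply/measurable_EFinP/measurable_sum => i; apply: measurable_funX.
    exact: (measurable_sub_sigma (@GT i) (mc i)).
  - by move=> w _; rewrite /= lee_fin (ger0_norm (s0 n w)) ger0_norm// cK.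
  - exact: finite_measure_integrable_cst.
pose u n : R := fine (\int[P]_w (s n w)%:E)%E.
have uE n : (\int[P]_w (s n w)%:E)%E = (u n)%:E.
  by rewrite fineK// integrable_fin_num.
have s_le m n w : (m <= n)%N -> s m w <= s n w.
  move=> mn; rewrite /s -!(big_mkord predT (fun i => c i w ^+ 2)).
  rewrite (big_cat_nat (leq0n m) mn)//= lerDl sumr_ge0// => i _.
  exact: sqr_ge0.
have u_le : {homo u : m n / (m <= n)%N >-> m <= n}.
  move=> m n mn; rewrite -lee_fin -!uE; apply: ge0_le_integral => //.
  - by move=> w _; rewrite lee_fin.
  - by case/integrableP : (si m).
  - by case/integrableP : (si n).
  - by move=> w _; rewrite lee_fin s_le.
have ucvg : cvgn u.
  apply: nondecreasing_is_cvgn => //; exists K => _ [n _ <-].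
  rewrite -lee_fin -uE; apply: (@le_trans _ _ (\int[P]_w K%:E)%E).
    apply: ge0_le_integral => //.
    - by move=> w _; rewrite lee_fin.
    - by case/integrableP : (si n).
    - by move=> w _; rewrite lee_fin cK.
  by rewrite integral_cst//= probability_setT mule1.
(* With the weights before [m] set to 0, the transform becomes the increment since time [m]. *)
pose cm m i w : R := if (m <= i)%N then c i w else 0.
have pcm m : predictable (cm m).
  split=> [n|n w /cF|].
  - by rewrite /cm; case: (m <= n)%N; [exact: mc|exact: measurable_cst].
  - by rewrite /cm => ->; rewrite if_same.
  - exists B => n w; rewrite /cm; case: ifP => // _.
    by rewrite normr0; apply: le_trans (cB n w).
have cmE (f : R -> nat -> R) m n w : (forall i, f 0 i = 0) -> (m <= n)%N ->
    \sum_(i < n) f (cm m i w) i =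
    \sum_(i < n) f (c i w) i - \sum_(i < m) f (c i w) i.
  move=> f0 mn; rewrite -(big_mkord predT (fun i => f (cm m i w) i)).
  rewrite -!(big_mkord predT (fun i => f (c i w) i)).
  rewrite !(big_cat_nat (leq0n m) mn)//=.
  rewrite big_nat big1 ?add0r => [|i /andP[_ im]]; last first.
    by rewrite /cm leqNgt im.
  rewrite addrAC subrr add0r; apply: eq_big_nat => i /andP[mi _].
  by rewrite /cm mi.
have tE m n w : (m <= n)%N ->
    transform (cm m) n w = transform c n w - transform c m w.
  by apply: (cmE (fun x i => x * h (X i w))) => i; rewrite mul0r.
have sE m n w : (m <= n)%N -> \sum_(i < n) cm m i w ^+ 2 = s n w - s m w.
  by apply: (cmE (fun x _ => x ^+ 2)) => i; rewrite expr0n.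
pose A (e : R) m n := \bigcup_(j in [set j | (j <= n)%N])
  [set w | e <= `|transform (cm m) j w|].
have mA e m n : measurable (A e m n).
  by apply: bigcup_measurable => j _; exact: measurable_transform_ge.
have osc (e : R) : 0 < e -> \forall w \ae P, exists m, forall j, (m <= j)%N ->
    `|transform c j w - transform c m w| < e.
  move=> e0; pose E m := \bigcup_n A e m n.
  have mE m : measurable (E m) by exact: bigcupT_measurable.
  have PE m (b : R) : (forall n, (m <= n)%N -> u n - u m <= b) ->
      (P (E m) <= (var / e ^+ 2 * b)%:E)%E.
    move=> ub; have ndA : {homo A e m : n k / (n <= k)%N >-> (n <= k)%O}.
      move=> n k nk; apply/subsetPset => w [j jn ej]; exists j => //.
      exact: leq_trans nk.
    have PA := nondecreasing_cvg_mu (mA e m) (mE m) ndA (mu := P).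
    rewrite -(cvg_lim _ PA)//; apply: lime_le; first exact: cvgP PA.
    near=> n; have mn : (m <= n)%N by near: n; exact: nbhs_infty_ge.
    rewrite /=; apply: le_trans (transform_maximal_inequality n (pcm m) e0) _.
    under eq_integral do rewrite sE// EFinB.
    rewrite integralB// !uE -EFinB -EFinM lee_fin ler_wpM2l ?ub//.
    by rewrite divr_ge0// exprn_ge0// ltW.
  (* One good [m] suffices, so the exceptional set is the intersection of all [E m]. *)
  exists (\bigcap_m E m); split; first exact: bigcapT_measurable.
    apply/eqP; rewrite eq_le measure_ge0 andbT.
    apply/lee_addgt0Pr => b b0; rewrite add0e.
    (* This makes the bound [b * (var / (var + 1)) <= b]; the 1 guards against [var = 0]. *)
    pose b' := b * e ^+ 2 / (var + 1).
    have v1 : 0 < var + 1 by apply: ltr_wpDl.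
    have b'0 : 0 < b' by rewrite divr_gt0// mulr_gt0// exprn_gt0.
    have [m um] : exists m, limn u - b' <= u m.
      move/cvgrPdist_le : ucvg => /(_ _ b'0) [m _ /(_ m (leqnn m))] /=.
      by rewrite ler_norml => /andP[_ ?]; exists m; lra.
    apply: (@le_trans _ _ (P (E m))).
      apply: le_measure; rewrite ?inE//; first exact: bigcapT_measurable.
      exact: bigcap_inf.
    have ub n : (m <= n)%N -> u n - u m <= b'.
      by move=> _; have := nondecreasing_cvgn_le u_le ucvg n; lra.
    apply: le_trans (PE m b' ub) _; rewrite lee_fin.
    rewrite (_ : _ * b' = b * (var / (var + 1))); last first.
      by rewrite /b'; field; rewrite !gt_eqF.
    by rewrite ler_piMr ?(ltW b0)// ler_pdivrMr// mul1r lerDl.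
  move=> w /= /forallNP H m _; have /existsNP[j /not_implyP[mj /negP]] := H m.
  by rewrite -leNgt => ej; exists j => //; exists j => //=; rewrite tE.
have : \forall w \ae P, forall k, exists m, forall j, (m <= j)%N ->
    `|transform c j w - transform c m w| < k.+1%:R^-1.
  by apply: ae_foralln => k; apply: osc; rewrite invr_gt0.
apply: filterS => w H; apply/cauchy_cvgP/cauchy_exP => e e0.
have [k ke] : exists k, k.+1%:R^-1 < e.
  near \oo => k; exists k; near: k; exact: near_infty_natSinv_lt (PosNum e0).
have [m Hm] := H k.
exists (transform c m w), m => // j /= mj.
by rewrite -ball_normE /= distrC; apply: lt_trans (Hm j mj) ke.
Unshelve. all: by end_near. Qed.

(* Cutting the weights [a] off once the sum of their squares exceeds [K] makes
   them bounded and predictable; for almost every [w] some [K] cuts nothing. *)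
Lemma weighted_noise_ae_cvg (a : nat -> T -> R) :
  (forall n, measurable_fun [set: g_sigma_algebraType (G n)] (a n)) ->
  (\forall w \ae P, (forall n, ~ F n w -> a n w = 0) /\
     (\sum_(t <oo) (a t w ^+ 2)%:E < +oo)%E) ->
  \forall w \ae P, cvgn (series (fun n => a n w * h (X n w))).
Proof.
move=> ma a2.
pose q n w : R := \sum_(i < n) a i w ^+ 2.
have mq n : measurable_fun [set: g_sigma_algebraType (G n)] (q n.+1).
  apply: (@measurable_sum _ (g_sigma_algebraType (G n)) R setT 'I_n.+1
    (index_enum _) (fun i w => a i w ^+ 2)) => i.
  apply: measurable_funX.
  exact: (measurable_sub_sigma_le (G_le (ltn_ord i : (i <= n)%N)) (ma i)).
(* The test includes the current weight, so the sum of squares never overshoots [K]; it is still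
   known at time [n] because [a n] is. The indicator makes the weight vanish off [F n] on every
   path, whereas [a n] does so only almost surely. *)
pose c (K : nat) n w : R :=
  \1_(F n) w * (if q n.+1 w <= K%:R then a n w else 0).
have cK K n w : \sum_(i < n) c K i w ^+ 2 <= K%:R.
  (* The comparison with [q] carries the induction: while [q n.+1 w <= K], it implies the bound by
     [K]. *)
  suff [] : \sum_(i < n) c K i w ^+ 2 <= K%:R /\
    \sum_(i < n) c K i w ^+ 2 <= q n w by [].
  elim: n => [|n [IH1 IH2]]; first by rewrite /q !big_ord0.
  have c2 : c K n w ^+ 2 <= a n w ^+ 2.
    rewrite /c indicE; case: (w \in F n);
      rewrite ?mul0r ?mul1r ?expr0n ?sqr_ge0//.
    by case: ifP => // _; rewrite expr0n sqr_ge0.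
  have qn : q n.+1 w = q n w + a n w ^+ 2 by rewrite /q big_ord_recr.
  rewrite big_ord_recr/=; split; last by rewrite qn lerD.
  have [qK|qK] := leP (q n.+1 w) K%:R.
    by apply: le_trans qK; rewrite qn lerD.
  by rewrite /c (lt_geF qK) mulr0 expr0n addr0.
have pc K : predictable (c K).
  split=> [n|n w Fw|].
  - apply: measurable_funM.
      exact: (@measurable_indic _ (g_sigma_algebraType (G n)) R setT _ (@GF n)).
    apply: measurable_fun_ifT; [|exact: ma|exact: measurable_cst].
    by apply: measurable_fun_ler; [exact: mq|exact: measurable_cst].
  - by rewrite /c indicE memNset// mul0r.
  - exists (K%:R + 1) => n w.
    have c2 : c K n w ^+ 2 <= K%:R.
      apply: le_trans (cK K n.+1 w); rewrite big_ord_recr/= lerDr.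
      by rewrite sumr_ge0// => i _; rewrite sqr_ge0.
    have K0 : 0 <= K%:R :> R by exact: ler0n.
    rewrite ler_norml; apply/andP; split; nra.
have : \forall w \ae P, forall K, cvgn (fun n => transform (c K) n w).
  by apply: ae_foralln => K; exact: transform_ae_cvg (pc K) (cK K).
apply: filterS2 a2 => w [aF qoo] cvgK.
have [K qK] : exists K, forall n, q n w <= K%:R.
  pose l := fine (\sum_(t <oo) (a t w ^+ 2)%:E)%E.
  have l0 : (0 <= \sum_(t <oo) (a t w ^+ 2)%:E)%E.
    by apply: nneseries_ge0 => n _ _; rewrite lee_fin sqr_ge0.
  have lE : (\sum_(t <oo) (a t w ^+ 2)%:E)%E = l%:E.
    by rewrite fineK// ge0_fin_numE.
  exists (Num.truncn l).+1 => n.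
  apply: (@le_trans _ _ l); last by rewrite ltW// truncnS_gt.
  rewrite -lee_fin -lE /q -sumEFin.
  rewrite -(big_mkord predT (fun i => (a i w ^+ 2)%:E)).
  by apply: nneseries_lim_ge => i _; rewrite lee_fin sqr_ge0.
have -> : series (fun n => a n w * h (X n w)) = (fun n => transform (c K) n w).
  apply/funext => n; rewrite seriesEord /transform; apply: eq_bigr => i _.
  congr (_ * _); rewrite /c qK indicE.
  have [Fw|Fw] := pselect (F i w); first by rewrite mem_set// mul1r.
  by rewrite memNset// mul0r aF.
exact: cvgK.
Qed.

End martingale.

(** * The noise of the algorithm *)

(** The hypothesis settles the value [true], complementation inside [D] settles [false], and [B] is
    one of four sets. This presents the arrival at a fixed successor state as a sample from a
    Bernoulli law. *)
Lemma bernoulli_probM (d : measure_display) (T : measurableType d)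
    (R : realType) (P : probability T R) (q : R) (D : set T) (X : T -> bool) :
  0 <= q <= 1 -> measurable D -> measurable [set w | X w] ->
  P (D `&` [set w | X w]) = (q%:E * P D)%E ->
  forall B, P (D `&` X @^-1` B) = (bernoulli_prob q B * P D)%E.
Proof.
move=> q01 mD mX PX B.
have PDf : P D = (fine (P D))%:E by rewrite fineK// fin_num_measure.
have PnX : P (D `&` [set w | ~~ X w]) = ((1 - q)%:E * P D)%E.
  have -> : D `&` [set w | ~~ X w] = D `\` (D `&` [set w | X w]).
    by rewrite setDIr setDv set0U; apply/seteqP; split=> w /= [Dw /negP].
  rewrite measureD//; last 2 first.
  - exact: measurableI.
  - by rewrite ltey_eq fin_num_measure.
  have -> : D `&` (D `&` [set w | X w]) = D `&` [set w | X w].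
    by rewrite setIA setIid.
  by transitivity (P D - q%:E * P D)%E; [rewrite -PX|
    rewrite PDf -!EFinM -EFinB mulrBl mul1r].
rewrite bernoulli_probE// !diracE /unstable.onem.
have [Bt|Bt] := pselect (B true); have [Bf|Bf] := pselect (B false);
  rewrite ?(mem_set Bt) ?(memNset Bt) ?(mem_set Bf) ?(memNset Bf) ?mule1 ?mule0
    ?adde0 ?add0e.
- rewrite -EFinD addrC subrK mul1e; congr (P _).
  by apply/seteqP; split=> w /=; [case|case: (X w)].
- rewrite -PX; congr (P _); apply/seteqP; split=> w /= [Dw];
    by case: (X w).
- rewrite -PnX; congr (P _); apply/seteqP; split=> w /= [Dw];
    by case: (X w).
- rewrite mul0e [X in P X](_ : _ = set0) ?measure0//.
  by apply/seteqP; split=> w //= [Dw]; case: (X w).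
Qed.

Lemma integral_bernoulli_centered (R : realType) (q : R) : 0 <= q <= 1 ->
  (\int[bernoulli_prob q]_b (b%:R - q)%:E = 0)%E.
Proof.
move=> q01.
have bint : (bernoulli_prob q).-integrable setT (fun b : bool => (b%:R : R)%:E).
  apply: (@le_integrable _ _ _ _ _ _ _ (cst 1%E)) => //.
  - by move=> [] _ /=; rewrite lee_fin ?normr1 ?normr0.
  - exact: finite_measure_integrable_cst.
under eq_integral do rewrite EFinB.
rewrite integralB//; last exact: finite_measure_integrable_cst.
rewrite integral_cst//= probability_setT mule1 integral_bernoulli_prob//.
by rewrite mule1 mule0 adde0 subee.
Qed.

Lemma integral_centered (R : realType) (rho : probability R R) :
  rho.-integrable setT (fun x => (x ^+ 2)%:E) ->
  rho.-integrable setT (fun x => ((x - mean_reward rho) ^+ 2)%:E) /\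
  (\int[rho]_x (x - mean_reward rho)%:E = 0)%E.
Proof.
move=> x2; set m := mean_reward rho.
have x1 : rho.-integrable setT (fun x : R => x%:E).
  exact: (square_integrable_integrable (@measurable_id _ _ setT) x2).
split.
  apply: (@le_integrable _ _ _ _ _ _ _
    (fun x : R => (2 * x ^+ 2)%:E + (2 * m ^+ 2)%:E)%E) => //.
  - apply/measurable_EFinP/measurable_funX; apply: measurable_funB => //.
  - move=> x _; rewrite /= lee_fin (ger0_norm (sqr_ge0 _)) ger0_norm.
      by have := sqr_ge0 (x + m); rewrite !expr2; lra.
    by rewrite addr_ge0// mulr_ge0// sqr_ge0.
  - apply: integrableD => //; last exact: finite_measure_integrable_cst.
    by under eq_fun do rewrite EFinM; exact: integrableZl.
under eq_integral do rewrite EFinB.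
rewrite integralB//; last exact: finite_measure_integrable_cst.
rewrite integral_cst//= probability_setT mule1 /m /mean_reward fineK ?subee//;
  exact: integrable_fin_num.
Qed.

Unset Implicit Arguments.

Theorem mainTheorem1
  (R : realType) (d : measure_display) (T : measurableType d)
  (P : probability T R)
  (S A : finType) (a0 : A)
  (p : S -> A -> S -> R) (rho : S -> A -> probability R R) (gamma : R)
  (Qstar : S -> A -> R) (g : R -> R -> R -> R) (amax : S -> (A -> R) -> A)
  (Q0 : tbl -> T -> S -> A -> R) (s_ : nat -> T -> S) (a_ : nat -> T -> A)
  (r_ : nat -> T -> R) (alpha : nat -> T -> S -> A -> R) :
  (* finite MDP: p(.|s,a) is a probability distribution on S *)
  (forall s a s', 0 <= p s a s') ->
  (forall s a, \sum_(s' : S) p s a s' = 1) ->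
  0 <= gamma < 1 ->
  (* (3) rewards have finite variance (finite second moment) *)
  (forall s a, (rho s a).-integrable setT (fun x => (x ^+ 2)%:E)) ->
  (* Q* solves the Bellman optimality equation *)
  (forall s a, Qstar s a = mean_reward (rho s a)
      + gamma * \sum_(s' : S) p s a s' * fmax a0 (Qstar s')) ->
  (* target mapping *)
  (g = @mean_two_smallest R \/ g = @median3 R) ->
  (* argmax with an arbitrary fixed tie-breaking rule *)
  (forall s (f : A -> R) a, f a <= f (amax s f)) ->
  (* measurability of the random quantities *)
  (forall X s a, measurable_fun setT (fun w => Q0 X w s a)) ->
  (forall t s, measurable (s_ t @^-1` [set s])) ->
  (forall t a, measurable (a_ t @^-1` [set a])) ->
  (forall t, measurable_fun setT (r_ t)) ->
  (forall t s a, measurable_fun setT (fun w => alpha t w s a)) ->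
  (* learning rates are determined by the history up to time t *)
  (forall t s a (B : set R), measurable B ->
     history Q0 s_ a_ r_ alpha t ((fun w => alpha t w s a) @^-1` B)) ->
  (* given the history, r_t is a sample of r(s_t, a_t) *)
  (forall t E s a (B : set R), history Q0 s_ a_ r_ alpha t E -> measurable B ->
     P (E `&` [set w | s_ t w = s /\ a_ t w = a /\ B (r_ t w)])
     = (rho s a B * P (E `&` [set w | s_ t w = s /\ a_ t w = a]))%E) ->
  (* given the history, s_{t+1} ~ p(. | s_t, a_t) *)
  (forall t E s a s', history Q0 s_ a_ r_ alpha t E ->
     P (E `&` [set w | s_ t w = s /\ a_ t w = a /\ s_ t.+1 w = s'])
     = ((p s a s')%:E * P (E `&` [set w | s_ t w = s /\ a_ t w = a]))%E) ->
  (* (1) every state-action pair is visited infinitely often (a.s.) *)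
  (\forall w \ae P, forall s a, forall N, exists t,
       (N <= t)%N /\ s_ t w = s /\ a_ t w = a) ->
  (* (2) learning-rate conditions, with probability 1 *)
  (\forall w \ae P, forall s a,
       (forall t, 0 <= alpha t w s a <= 1) /\
       (forall t, (s, a) <> (s_ t w, a_ t w) -> alpha t w s a = 0) /\
       (\sum_(t <oo) (alpha t w s a)%:E = +oo)%E /\
       (\sum_(t <oo) ((alpha t w s a) ^+ 2)%:E < +oo)%E) ->
  (* conclusion: Q^A_t, Q^B_t, Q^C_t all converge to Q* with probability 1 *)
  \forall w \ae P, forall X s a,
    (fun t => ctq gamma g amax (fun Y => Q0 Y w) (fun t => s_ t w)
                 (fun t => a_ t w) (fun t => r_ t w) (fun t => alpha t w) t X s a)
      @ \oo --> Qstar s a.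
Proof.
move=> p0 p1 g01 rho2 QE gE amaxP mQ0 ms ma mr mal alH rH sH _ alC.
pose G n := history_gen Q0 s_ a_ r_ alpha n.
have GT n E : <<s G n >> E -> measurable E.
  apply: smallest_sub; first exact: sigma_algebra_measurable.
  move=> {}E [[X [s [a [B [mB ->]]]]]|[[i [s [_ ->]]]|[[i [a [_ ->]]]|
    [[i [B [_ [mB ->]]]]|[i [s [a [B [_ [mB ->]]]]]]]]]] //.
  - by rewrite -[X in measurable X]setTI; exact: mQ0.
  - by rewrite -[X in measurable X]setTI; exact: mr.
  - by rewrite -[X in measurable X]setTI; exact: mal.
have GS n : <<s G n >> `<=` <<s G n.+1 >>.
  apply: sub_smallest2r; first exact: smallest_sigma_algebra.
  move=> E [[X [s [a [B [mB ->]]]]]|[[i [s [ni ->]]]|[[i [a [ni ->]]]|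
    [[i [B [ni [mB ->]]]]|[i [s [a [B [ni [mB ->]]]]]]]]]].
  - by left; exists X, s, a, B.
  - by right; left; exists i, s; rewrite (leqW ni).
  - by right; right; left; exists i, a; rewrite (leqW ni).
  - by right; right; right; left; exists i, B; rewrite ltnS ltnW.
  - by right; right; right; right; exists i, s, a, B; rewrite ltnS ltnW.
pose F s a n := [set w | s_ n w = s /\ a_ n w = a].
have GF s a n : <<s G n >> (F s a n).
  have -> : F s a n = s_ n @^-1` [set s] `&` a_ n @^-1` [set a] by [].
  apply: (@measurableI _ (g_sigma_algebraType (G n))); apply: sub_gen_smallest.
    by right; left; exists n, s.
  by right; right; left; exists n, a.
(* The generators at time [n] list only the rates before [n]; that [alpha n] is known at time [n] is
   the assumption on the learning rates. *)
have Gal n s a :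
    measurable_fun [set: g_sigma_algebraType (G n)] (fun w => alpha n w s a).
  by move=> _ B mB; rewrite setTI; exact: alH.
have al2 s a : \forall w \ae P,
    (forall n, ~ F s a n w -> alpha n w s a = 0) /\
    (\sum_(t <oo) (alpha t w s a ^+ 2)%:E < +oo)%E.
  apply: filterS alC => w /(_ s a) [_ [al0 [_ h]]]; split=> // n Fn.
  by apply: al0 => -[ss aa]; apply: Fn; rewrite ss aa.
(* Each pair is treated separately: when it is visited the reward is a sample from [rho s a], and
   otherwise its rate is 0 almost surely. *)
have rcvg s a : \forall w \ae P, cvgn (series (fun n =>
    alpha n w s a * (r_ n w - mean_reward (rho s a)))).
  have [r2 r1] := integral_centered (rho2 s a).
  apply: (@weighted_noise_ae_cvg _ _ T _ R P G (F s a) r_ (rho s a)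
    (fun x => x - mean_reward (rho s a))) => //.
  - move=> n _ B mB; rewrite setTI; apply: sub_gen_smallest.
    by right; right; right; left; exists n, B.
  - move=> n E B GE mB; rewrite -rH//; congr (P (E `&` _)).
    by apply/seteqP; split=> w /=; rewrite /F /=; tauto.
  - by apply: measurable_funB.
have p01 s a s' : 0 <= p s a s' <= 1.
  rewrite p0 -(p1 s a) (bigD1 s')//= lerDl sumr_ge0// => i _; exact: p0.
(* Transition noise is treated one successor at a time, through the indicator of arriving at
   [s']. *)
have scvg s a s' : \forall w \ae P, cvgn (series (fun n =>
    alpha n w s a * ((s_ n.+1 w == s')%:R - p s a s'))).
  apply: (@weighted_noise_ae_cvg _ _ T _ R P G (F s a)
    (fun n w => s_ n.+1 w == s') (bernoulli_prob (p s a s'))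
    (fun b : bool => b%:R - p s a s')) => //.
  - move=> n.
    apply: (@measurable_fun_bool _ (g_sigma_algebraType (G n.+1)) _ _ true).
    rewrite setTI; apply: sub_gen_smallest; right; left; exists n.+1, s'.
    by split=> //; apply/seteqP; split=> w /eqP.
  - move=> n E B GE mB; rewrite setIA.
    apply: bernoulli_probM => //.
    + by apply: measurableI; [exact: GT GE|exact: GT (GF s a n)].
    + rewrite [X in measurable X](_ : _ = s_ n.+1 @^-1` [set s'])//.
      by apply/seteqP; split=> w /eqP.
    + rewrite -sH// -setIA; congr (P (E `&` _)).
      by apply/seteqP; split=> w /=; rewrite /F /=; [move=> [[? ?] /eqP]|
        move=> [? [? /eqP]]].
  - apply: (@le_integrable _ _ _ _ _ _ _ (cst 1%E)) => //.
    + move=> b _; have /andP[h0 h1] := p01 s a s'.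
      rewrite /= lee_fin normr1 ger0_norm ?sqr_ge0//.
      by case: b => /=; nra.
    + exact: finite_measure_integrable_cst.
  - exact: integral_bernoulli_centered.
have rcvg' : \forall w \ae P, forall s a, cvgn (series (fun n =>
    alpha n w s a * (r_ n w - mean_reward (rho s a)))).
  by apply: filter_forall => s; apply: filter_forall => a.
have scvg' : \forall w \ae P, forall s a s', cvgn (series (fun n =>
    alpha n w s a * ((s_ n.+1 w == s')%:R - p s a s'))).
  apply: filter_forall => s; apply: filter_forall => a.
  exact: filter_forall.
apply: filterS3 alC rcvg' scvg' => w al r s.
apply: (ctq_cvg_path (a0 := a0)) => //.
- move=> x y z; case: gE => ->.
    exact: mean_two_smallest_near.
  exact: median3_near.
- by move=> t s' a; case: (al s' a) => + _; exact.
- by move=> t s' a; case: (al s' a) => _ [+ _]; exact.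
- by move=> s' a; case: (al s' a) => _ [_ []].
move=> s' a.
(* By the Bellman equation the noise is the reward noise plus a finite combination of the centred
   arrival indicators with the fixed coefficients [gamma * V x], so its series converges. *)
pose V := fmax a0 \o Qstar.
have -> : (fun t => alpha t w s' a *
     (r_ t w + gamma * fmax a0 (Qstar (s_ t.+1 w)) - Qstar s' a)) =
  (fun t => alpha t w s' a * (r_ t w - mean_reward (rho s' a)) +
    \sum_x gamma * V x * (alpha t w s' a * ((s_ t.+1 w == x)%:R - p s' a x))).
  apply/funext => t.
  have -> : fmax a0 (Qstar (s_ t.+1 w)) = \sum_x V x * (s_ t.+1 w == x)%:R.
    rewrite (bigD1 (s_ t.+1 w))//= eqxx mulr1 big1 ?addr0// => x.
    by rewrite eq_sym => /negbTE ->; rewrite mulr0.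
  rewrite QE.
  have -> : \sum_x gamma * V x *
      (alpha t w s' a * ((s_ t.+1 w == x)%:R - p s' a x)) =
    alpha t w s' a * gamma * (\sum_x V x * (s_ t.+1 w == x)%:R -
      \sum_x p s' a x * V x).
    rewrite -sumrB mulr_sumr; apply: eq_bigr => x _; ring.
  by rewrite /V /=; ring.
have -> : series (fun t => alpha t w s' a * (r_ t w - mean_reward (rho s' a)) +
    \sum_x gamma * V x * (alpha t w s' a * ((s_ t.+1 w == x)%:R - p s' a x))) =
  (fun n => series (fun t => alpha t w s' a *
      (r_ t w - mean_reward (rho s' a))) n +
    \sum_x gamma * V x * series (fun t =>
      alpha t w s' a * ((s_ t.+1 w == x)%:R - p s' a x)) n).
  apply/funext => n; rewrite /series /= big_split/=; congr (_ + _).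
  by rewrite exchange_big/=; apply: eq_bigr => x _; rewrite mulr_sumr.
apply: is_cvgD; first exact: r.
apply: cvgP; apply: (@cvg_big _ _ +%R) => [|x _]; first exact: add_continuous.
by apply: cvgM; [exact: cvg_cst|exact: s].
Qed.
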